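(* Let $(\phi^k,\psi^k,\theta^k)_k$ be generated by the iteration described in the context. If the error terms satisfy $\sum_k\epsilon_L^k<\infty$ and $\sum_k\epsilon_x^k<\infty$, then $x_{\theta^k}$ converges to the optimal solution of the linear program $$\begin{aligned}\max_{x\ge0}\ &\sum_{s,a}r(s,a)w(s,a)x(s,a)\\ \text{s.t. }&\sum_a w(s',a)x(s',a)-\sum_{s,a}\gamma P(s'|s,a)w(s,a)x(s,a)=\rho_0(s')\quad\forall s'\in\mathcal S .\end{aligned}$$
   Context: $\mathcal S$ and $\mathcal A$ are finite sets (state and action spaces), $P(s'|s,a)$ is a transition probability kernel, $r:\mathcal S\times\mathcal A\to\mathbb R$ is a bounded reward function, $\rho_0$ is a probability distribution on $\mathcal S$, $\gamma\in(0,1)$, and $\mu>0$. The weight $w$ is a probability distribution on $\mathcal S\times\mathcal A$ with $w(s,a)>0$ for all $(s,a)$. For $V:\mathcal S\to\mathbb R$ and $h,x:\mathcal S\times\mathcal A\to\mathbb R$ define $$Z_\mu(V,h,x,s,a)=x(s,a)+\mu\Bigl(h(s,a)+r(s,a)+\gamma\sum_{s'}P(s'|s,a)V(s')-V(s)\Bigr),$$ $$\mathcal L_\mu(V,h,x)=\sum_s\rho_0(s)V(s)+\frac1{2\mu}\sum_{s,a}w(s,a)\,[Z_\mu(V,h,x,s,a)]^2 .$$ Parametrized families: $V_\phi:\mathcal S\to\mathbb R$, $h_\psi:\mathcal S\times\mathcal A\to[0,\infty)$ (nonnegativity is guaranteed by the parametrization), $x_\theta:\mathcal S\times\mathcal A\to\mathbb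 R$. Iteration: given $\theta^k$, the next parameters $(\phi^{k+1},\psi^{k+1},\theta^{k+1})$ are obtained by (possibly inexactly) solving $$\min_{\phi,\psi,\theta}\ \sum_s\rho_0(s)V_\phi(s)+\frac1\mu\sum_{s,a}w(s,a)x_\theta(s,a)Z_\mu(V_\phi,h_\psi,x_{\theta^k},s,a)\quad\text{s.t. } x_\theta(s,a)=Z_\mu(V_\phi,h_\psi,x_{\theta^k},s,a)\ \ \forall s,a .$$ No accuracy is prescribed; the optimization and parametrization errors are measured by $$\epsilon_L^k=\mathcal L_\mu(V_{\phi^{k+1}},h_{\psi^{k+1}},x_{\theta^k})-\inf_{h\ge0,V}\mathcal L_\mu(V,h,x_{\theta^k}),$$ $$\epsilon_x^k=\sum_{s,a}w(s,a)\bigl(x_{\theta^{k+1}}(s,a)-Z_\mu(V_{\phi^{k+1}},h_{\psi^{k+1}},x_{\theta^k},s,a)\bigr)^2 ,$$ where the infimum is over all functions $V:\mathcal S\to\mathbb R$ and $h:\mathcal S\times\mathcal A\to[0,\infty)$. The paper regards this iteration as equivalent, up to a positive scaling of the linear program's objective, to an approximate augmented Lagrangian update.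
   Formalization: The linear program may have several optimal solutions, and then the iterates need not converge to a single one; the formal statement proves that their distance to the set of optimal solutions tends to 0, and that they converge to the optimal solution whenever it is unique. *)

(* Defs.v *)
From mathcomp Require Import all_boot all_order all_algebra.
From mathcomp Require Import all_classical all_reals all_analysis.
Set Implicit Arguments.
Unset Strict Implicit.
Unset Printing Implicit Defensive.
Import Order.TTheory GRing.Theory Num.Theory.
Import numFieldNormedType.Exports.
Local Open Scope classical_set_scope.
Local Open Scope ring_scope.

Definition is_distribution (R : realType) (T : finType) (p : T -> R) : Prop :=
  (forall t, 0 <= p t) /\ \sum_(t : T) p t = 1.

(* [P s a s'] is the probability P(s'|s,a). *)
Definition is_kernel (R : realType) (S A : finType) (P : S -> A -> S -> R) :
    Prop :=
  forall s a, is_distribution (P s a).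

Definition Zmu (R : realType) (S A : finType) (P : S -> A -> S -> R)
    (r : S -> A -> R) (gamma mu : R)
    (V : S -> R) (h x : S -> A -> R) (s : S) (a : A) : R :=
  x s a + mu * (h s a + r s a + gamma * (\sum_(s' : S) P s a s' * V s') - V s).

Definition Lmu (R : realType) (S A : finType) (P : S -> A -> S -> R)
    (r : S -> A -> R) (rho0 : S -> R) (w : S -> A -> R) (gamma mu : R)
    (V : S -> R) (h x : S -> A -> R) : R :=
  \sum_(s : S) rho0 s * V s
  + (2 * mu)^-1
    * \sum_(s : S) \sum_(a : A) w s a * Zmu P r gamma mu V h x s a ^+ 2.

(* The infimum is taken in the extended reals, so that no junk value can occur
   should the set of values fail to be bounded below. *)
Definition inf_Lmu (R : realType) (S A : finType) (P : S -> A -> S -> R)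
    (r : S -> A -> R) (rho0 : S -> R) (w : S -> A -> R) (gamma mu : R)
    (x : S -> A -> R) : \bar R :=
  ereal_inf [set l : \bar R | exists (V : S -> R) (h : S -> A -> R),
    (forall s a, 0 <= h s a) /\ l = (Lmu P r rho0 w gamma mu V h x)%:E].

(* In [eps_L] and [eps_x], [x] is the previous multiplier x_(theta^k), while
   [V], [h] and [x'] are the new V, h and x at step k+1. *)
Definition eps_L (R : realType) (S A : finType) (P : S -> A -> S -> R)
    (r : S -> A -> R) (rho0 : S -> R) (w : S -> A -> R) (gamma mu : R)
    (V : S -> R) (h x : S -> A -> R) : \bar R :=
  ((Lmu P r rho0 w gamma mu V h x)%:E - inf_Lmu P r rho0 w gamma mu x)%E.

Definition eps_x (R : realType) (S A : finType) (P : S -> A -> S -> R)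
    (r : S -> A -> R) (w : S -> A -> R) (gamma mu : R)
    (V : S -> R) (h x x' : S -> A -> R) : R :=
  \sum_(s : S) \sum_(a : A)
    w s a * (x' s a - Zmu P r gamma mu V h x s a) ^+ 2.

Definition lp_objective (R : realType) (S A : finType)
    (r w x : S -> A -> R) : R :=
  \sum_(s : S) \sum_(a : A) r s a * w s a * x s a.

Definition lp_feasible (R : realType) (S A : finType) (P : S -> A -> S -> R)
    (rho0 : S -> R) (w : S -> A -> R) (gamma : R) : set (S -> A -> R) :=
  [set x | (forall s a, 0 <= x s a) /\
    forall s' : S,
      \sum_(a : A) w s' a * x s' a
      - \sum_(s : S) \sum_(a : A) gamma * P s a s' * w s a * x s a
      = rho0 s'].

Definition lp_optimal (R : realType) (S A : finType) (P : S -> A -> S -> R)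
    (r : S -> A -> R) (rho0 : S -> R) (w : S -> A -> R) (gamma : R) :
    set (S -> A -> R) :=
  [set x | lp_feasible P rho0 w gamma x /\
    forall y, lp_feasible P rho0 w gamma y ->
      lp_objective r w y <= lp_objective r w x].

(* The distance of [u k] to the set [X] tends to 0; in particular [X] is
   nonempty.  For [X = [set l]] this is the usual convergence to [l]. *)
Definition cvg_to_set (R : realType) (S A : finType)
    (u : nat -> S -> A -> R) (X : set (S -> A -> R)) : Prop :=
  forall e : R, 0 < e ->
    \forall k \near \oo, exists2 y, X y & forall s a, `|u k s a - y s a| < e.

(* Main.v *)
Require Import Defs.
From mathcomp Require Import all_boot all_order all_algebra.
From mathcomp Require Import all_classical all_reals all_analysis.
From mathcomp Require Import ring lra.
Set Implicit Arguments.
Unset Strict Implicit.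
Unset Printing Implicit Defensive.
Import Order.TTheory GRing.Theory Num.Theory.
Import numFieldNormedType.Exports.
Local Open Scope classical_set_scope.
Local Open Scope ring_scope.

(** The multipliers follow an inexact proximal point method for the linear
    program.  Write [Z] for [Zmu V h x], with [x] the current multiplier and
    [(V, h)] the approximate minimizer of [Lmu].  The terms of the two error
    series tend to 0, so that [(V, h)] is suboptimal by a vanishing amount, and
    the next multiplier gets close to [Z].

    Suboptimality is exploited by testing [Lmu] against a few directions.  As
    [Lmu] is quadratic, with linear term given by the adjoint of the constraints
    ([wdot_bellman], [Lmu_shift]), changing one value of [V] shows that [Z]
    almost satisfies the flow constraint, raising one value of [h] that [Z] is
    almost nonnegative, and scaling [(V, h)] down that [Z] almost satisfies the
    variational inequality of the proximal point of the linear program at [x]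
    ([suboptimal_near_feasible], [suboptimal_variational]).

    The variational inequality and the law of cosines ([wdist2_Zmu]) give, for
    every solution [p] of the linear program and up to vanishing errors,

      |Z - p|^2 <= |x - p|^2 - 2 mu (objective p - objective Z)

    in the [w]-weighted norm.  The constraints fix the total mass of a feasible
    point, since [gamma < 1]; so nearly feasible points are bounded
    ([near_feasible_bounded]).  By compactness a feasible point and a solution
    exist, and a nearly feasible point with nearly optimal objective is near a
    solution ([near_optimal_near_solution]).  Each step thus either lands near
    the solution set or decreases the distance to all solutions by a fixed
    amount, and [quasi_descent_cvg] concludes that the distance to the solution
    set tends to 0. *)

(** * Sequences and series *)

Lemma bounded_cluster (R : realType) (S A : finType) (u : nat -> S -> A -> R)
    (B : R) :
  (forall n s a, `|u n s a| <= B) ->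
  exists l : S -> A -> R, forall e, 0 < e -> forall N, exists2 n,
    (N <= n)%N & forall s a, `|u n s a - l s a| <= e.
Proof.
move=> uB; pose T : finType := (S * A)%type.
pose v n : 'rV[R]_#|T| :=
  \row_i u n (enum_val i : T).1 (enum_val i : T).2.
pose box := [set z : 'rV[R]_#|T| | forall i, `[- B, B]%classic (z ord0 i)].
have cbox : compact box.
  apply: (@rV_compact R _ (fun=> `[- B, B]%classic)) => i.
  exact: segment_compact.
have vbox : (v @ \oo) box.
  exists 0%N => // n _ i /=; rewrite in_itv /= mxE -ler_norml; exact: uB.
have [l [_ cl]] := cbox _ _ vbox.
exists (fun s a => l ord0 (enum_rank ((s, a) : T))) => e e0 N.
have tail : (v @ \oo) [set v n | n in [set n | (N <= n)%N]].
  by exists N => // n /= Nn; exists n.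
have nbl : nbhs l [set z : 'rV[R]_#|T| | forall i, `|l ord0 i - z ord0 i| < e].
  exists (fun i j => ball (l i j) e); first by move=> i j; exact: nbhsx_ballx.
  by move=> z /= lz i; exact: lz.
have [z [[n /= Nn <-] lz]] := cl _ _ tail nbl.
exists n => // s a.
have := lz (enum_rank ((s, a) : T)).
by rewrite mxE enum_rankK /= distrC => /ltW.
Qed.

(** The argument of quasi-Fejer convergence, without any rate.  Fix [e] and the
    corresponding [c].  Once the alternative holds at every step, a point at
    distance at most [e] from [X] stays there: either the first alternative
    holds again, or the distance to the same [p] decreases.  The threshold is
    reached, since otherwise the nonnegative distance to one fixed element of
    [X] would drop by [c] at every step. *)
Lemma quasi_descent_cvg (R : realType) (T : Type) (X : set T)
    (d : nat -> T -> R) :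
  X !=set0 -> (forall k p, 0 <= d k p) ->
  (forall e, 0 < e -> exists2 c, 0 < c & \forall k \near \oo,
     (exists2 p, X p & d k.+1 p <= e) \/
     (forall p, X p -> d k.+1 p <= d k p - c)) ->
  forall e, 0 < e -> \forall k \near \oo, exists2 p, X p & d k p <= e.
Proof.
move=> [p0 Xp0] d0 step e /step[c c0 [K _ Kstep]].
have stay k : (K <= k)%N -> (exists2 p, X p & d k p <= e) ->
    exists2 p, X p & d k.+1 p <= e.
  move=> /Kstep[//|desc] [p Xp dp]; exists p => //.
  by have := desc p Xp; lra.
have reach n : (exists2 p, X p & d (K + n)%N p <= e) \/
    d (K + n)%N p0 <= d K p0 - c *+ n.
  elim: n => [|n [near|far]]; first by right; rewrite addn0 mulr0n subr0.
    by left; rewrite addnS; apply: stay => //; exact: leq_addr.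
  rewrite addnS; have [|//|desc] := Kstep (K + n)%N; first exact: leq_addr.
    by left.
  by right; rewrite mulrS; have := desc p0 Xp0; lra.
have [n dn] : exists n : nat, d K p0 < c *+ n.
  exists (Num.bound (d K p0 / c)).
  rewrite -mulr_natr mulrC -ltr_pdivrMr//.
  by apply: archi_boundP; rewrite divr_ge0// ltW.
have nearn : exists2 p, X p & d (K + n)%N p <= e.
  by have [//|] := reach n; have := d0 (K + n)%N p0; lra.
exists (K + n)%N => // k /= /subnKC <-.
elim: (k - (K + n))%N => [|m IH]; first by rewrite addn0.
by rewrite addnS; apply: stay => //; rewrite -addnA leq_addr.
Qed.

Lemma nneseries_term_near0 (R : realType) (f : nat -> \bar R) :
  (forall k, 0 <= f k)%E -> (\sum_(0 <= k <oo) f k < +oo)%E ->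
  forall e : R, 0 < e -> \forall k \near \oo, (f k <= e%:E)%E.
Proof.
move=> f0 fsum e e0.
have tail := nneseries_tail_cvg fsum (fun k _ => f0 k).
have /tail[N _ small] : nbhs (0 : \bar R)%E [set y | (y < e%:E)%E].
  by apply: open_ereal_lt'; rewrite lte_fin.
exists N => // k /small /ltW; apply: le_trans => /=.
rewrite (nneseries_split _ 1)// addn1 big_nat1.
by rewrite leeDl//; apply: nneseries_ge0 => *; exact: f0.
Qed.

(** Replaces square roots and quotients when a step length [t] has to make
    a prescribed multiple of itself small. *)
Lemma small_factor (R : realType) (C q : R) : 0 <= C -> 0 < q ->
  exists2 t, 0 < t <= 1 & t * C <= q.
Proof.
move=> C0 q0; have qC : 0 < q + C by rewrite ltr_pwDl.
exists (q / (q + C)).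
  by rewrite divr_gt0//= ler_pdivrMr// mul1r lerDl.
by rewrite mulrAC ler_pdivrMr// ler_wpM2l ?lerDr// ltW.
Qed.

(** * Linear forms at cluster points *)

Definition dot (R : realType) (S A : finType) (c y : S -> A -> R) : R :=
  \sum_s \sum_a c s a * y s a.

(** Closeness is uniform over the finitely many coordinates, so a single index
    serves all of them. *)
Definition clusters (R : realType) (S A : finType) (z : nat -> S -> A -> R)
    (l : S -> A -> R) : Prop :=
  forall e, 0 < e -> forall N, exists2 n,
    (N <= n)%N & forall s a, `|z n s a - l s a| <= e.

Lemma sum2_ge0 (R : realType) (S A : finType) (F : S -> A -> R) :
  (forall s a, 0 <= F s a) -> 0 <= \sum_s \sum_a F s a.
Proof. by move=> F0; apply: sumr_ge0 => s _; apply: sumr_ge0. Qed.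

Lemma term_le_sum2 (R : realType) (S A : finType) (F : S -> A -> R) s a :
  (forall s a, 0 <= F s a) -> F s a <= \sum_s \sum_a F s a.
Proof.
move=> F0; rewrite (bigD1 s)//= (bigD1 a)//= -addrA lerDl addr_ge0//.
  by apply: sumr_ge0.
by apply: sumr_ge0 => ? _; apply: sumr_ge0.
Qed.

Lemma dot_lipschitz (R : realType) (S A : finType) (c y z : S -> A -> R) e :
  (forall s a, `|y s a - z s a| <= e) ->
  `|dot c y - dot c z| <= e * \sum_s \sum_a `|c s a|.
Proof.
move=> yz; rewrite /dot -sumrB mulr_sumr.
apply: le_trans (ler_norm_sum _ _ _) _; apply: ler_sum => s _.
rewrite -sumrB mulr_sumr.
apply: le_trans (ler_norm_sum _ _ _) _; apply: ler_sum => a _.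
by rewrite -mulrBr normrM mulrC ler_wpM2r.
Qed.

(** A linear form is Lipschitz, so an inequality that holds along the sequence
    up to a vanishing error survives at a cluster point.  Both feasibility and
    optimality for a linear program are inequalities of this kind. *)
Lemma clusters_ge (R : realType) (S A : finType) (z : nat -> S -> A -> R)
    (l c : S -> A -> R) (b : R) :
  clusters z l ->
  (forall e, 0 < e -> \forall n \near \oo, b - e <= dot c (z n)) ->
  b <= dot c l.
Proof.
move=> zl zb; apply/ler_addgt0Pl => e e0.
pose C := 1 + \sum_s \sum_a `|c s a|.
have C0 : 0 < C by rewrite ltr_pwDl// sum2_ge0.
have [|N _ {}zb] := zb (e / 2); first by rewrite divr_gt0.
have [|n Nn zln] := zl (e / 2 / C) _ N; first by rewrite !divr_gt0.
have := dot_lipschitz c zln; have := zb n Nn => /=.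
have : e / 2 / C * \sum_s \sum_a `|c s a| <= e / 2.
  rewrite mulrAC ler_pdivrMr// ler_pM2l ?divr_gt0// /C; lra.
rewrite ler_norml => ? ? /andP[]; lra.
Qed.

(** * Duality between flows and Bellman residuals *)

Section MarkovDecisionProcess.
Context (R : realType) (S A : finType).
Context (P : S -> A -> S -> R) (hP : is_kernel P).
Context (r : S -> A -> R).
Context (rho0 : S -> R) (hrho0 : is_distribution rho0).
Context (gamma : R) (hgamma : 0 < gamma < 1).
Context (mu : R) (hmu : 0 < mu).
Context (w : S -> A -> R).
Context (hw : is_distribution (fun sa : S * A => w sa.1 sa.2)).
Context (hw0 : forall s a, 0 < w s a).

Local Notation Z := (Zmu P r gamma mu).
Local Notation L := (Lmu P r rho0 w gamma mu).
Local Notation feasible := (lp_feasible P rho0 w gamma).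
Local Notation optimal := (lp_optimal P r rho0 w gamma).
Local Notation objective := (lp_objective r w).

Definition wdot (u v : S -> A -> R) : R := \sum_s \sum_a w s a * u s a * v s a.

(** The linear part of the Bellman residual with slack: the residual itself is
    [bellman V h + r], and the reward is left out so that [bellman] is linear
    in [(V, h)], as needed of a direction of perturbation. *)
Definition bellman (V : S -> R) (h : S -> A -> R) (s : S) (a : A) : R :=
  h s a + gamma * (\sum_s' P s a s' * V s') - V s.

(** The left-hand side of the flow constraint of the linear program. *)
Definition netflow (y : S -> A -> R) (s' : S) : R :=
  \sum_a w s' a * y s' a - \sum_s \sum_a gamma * P s a s' * w s a * y s a.

Lemma sum_w : \sum_s \sum_a w s a = 1.
Proof. by have [_ <-] := hw; rewrite pair_bigA. Qed.

Lemma w_ge0 s a : 0 <= w s a.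
Proof. exact: ltW. Qed.

Lemma w_lbound : exists2 m, 0 < m & m <= 1 /\ forall s a, m <= w s a.
Proof.
exists (\big[Num.min/1]_(sa : S * A) w sa.1 sa.2).
  by apply: lt_bigmin => //= -[s a] _.
split; first exact: bigmin_le_id.
move=> s a.
by apply: (@bigmin_le_cond _ _ _ _ (s, a) _ (fun sa => w sa.1 sa.2)).
Qed.

Lemma netflow_dot y s' :
  netflow y s' = dot (fun s a => ((s == s')%:R - gamma * P s a s') * w s a) y.
Proof.
rewrite /netflow /dot.
under [RHS]eq_bigr => s _.
  under eq_bigr => a _ do rewrite mulrBl mulrBl -[X in X - _]mulrA.
  rewrite sumrB -mulr_sumr; over.
rewrite sumrB; congr (_ - _).
rewrite (bigD1 s')//= eqxx mul1r [X in _ = _ + X]big1 ?addr0// => s /negPf ->.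
by rewrite mul0r.
Qed.

(** The operator [(V, h) |-> bellman V h] is the adjoint of the constraint map
    [y |-> (- netflow y, y)] of the linear program.  This identity is the only
    form of duality in the proof. *)
Lemma wdot_bellman y V h :
  wdot y (bellman V h) = wdot y h - \sum_s netflow y s * V s.
Proof.
have -> : \sum_s netflow y s * V s =
    \sum_s \sum_a w s a * y s a * (V s - gamma * \sum_s' P s a s' * V s').
  under eq_bigr => s _ do rewrite /netflow mulrBl.
  rewrite sumrB.
  have -> : \sum_s (\sum_s0 \sum_a gamma * P s0 a s * w s0 a * y s0 a) * V s =
      \sum_s0 \sum_a w s0 a * y s0 a * (gamma * \sum_s P s0 a s * V s).
    under eq_bigr => s _ do rewrite mulr_suml.
    rewrite exchange_big; apply: eq_bigr => s0 _.
    under eq_bigr => s _ do rewrite mulr_suml.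
    rewrite exchange_big; apply: eq_bigr => a _.
    rewrite !mulr_sumr; apply: eq_bigr => s _; ring.
  rewrite -sumrB; apply: eq_bigr => s _.
  rewrite mulr_suml -sumrB; apply: eq_bigr => a _; ring.
rewrite /wdot -sumrB; apply: eq_bigr => s _.
rewrite -sumrB; apply: eq_bigr => a _; rewrite /bellman; ring.
Qed.

Lemma Zmu_bellman V h x s a :
  Z V h x s a = x s a + mu * (bellman V h s a + r s a).
Proof. by rewrite /Zmu /bellman; congr (_ + mu * _); ring. Qed.

Lemma bellmanD V h V' h' t s a :
  bellman (fun s => V s + t * V' s) (fun s a => h s a + t * h' s a) s a =
  bellman V h s a + t * bellman V' h' s a.
Proof.
rewrite /bellman.
have -> : \sum_s' P s a s' * (V s' + t * V' s') =
    \sum_s' P s a s' * V s' + t * \sum_s' P s a s' * V' s'.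
  by rewrite mulr_sumr -big_split; apply: eq_bigr => s' _ /=; ring.
ring.
Qed.

(** [Lmu] is quadratic in [(V, h)], with a Hessian that sees a direction only
    through its image under [bellman].  The linear coefficient pairs the
    direction with the constraint violations of [Zmu V h x]. *)
Lemma Lmu_shift V h x V' h' t :
  L (fun s => V s + t * V' s) (fun s a => h s a + t * h' s a) x =
  L V h x + t * (\sum_s rho0 s * V' s + wdot (Z V h x) (bellman V' h'))
    + t ^+ 2 * (mu / 2 * wdot (bellman V' h') (bellman V' h')).
Proof.
have mu0 : mu != 0 by rewrite gt_eqF.
rewrite /Lmu.
have -> : \sum_s rho0 s * (V s + t * V' s) =
    \sum_s rho0 s * V s + t * \sum_s rho0 s * V' s.
  by rewrite mulr_sumr -big_split; apply: eq_bigr => s' _ /=; ring.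
have -> : \sum_s \sum_a w s a * Z (fun s => V s + t * V' s)
      (fun s a => h s a + t * h' s a) x s a ^+ 2 =
    \sum_s \sum_a w s a * Z V h x s a ^+ 2 +
    2 * mu * t * wdot (Z V h x) (bellman V' h') +
    (mu * t) ^+ 2 * wdot (bellman V' h') (bellman V' h').
  rewrite /wdot 2!mulr_sumr -!big_split; apply: eq_bigr => s _ /=.
  rewrite 2!mulr_sumr -!big_split; apply: eq_bigr => a _ /=.
  by rewrite !Zmu_bellman bellmanD; ring.
by field; rewrite mu0.
Qed.

(** * Approximate optimality conditions of the inner problem *)

Definition suboptimal (e : R) V h x := forall V' h',
  (forall s a, 0 <= h' s a) -> L V h x <= L V' h' x + e.

(** If the infimum is missed by [t ^+ 2], a move of length [t] along an
    admissible direction gains at most [t ^+ 2]; dividing by [t], the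
    directional derivative is bounded below by a multiple of [t].  The error is
    written as a square to keep the length of the move explicit. *)
Lemma suboptimal_direction V h x V' h' t :
  0 < t -> suboptimal (t ^+ 2) V h x ->
  (forall s a, 0 <= h s a + t * h' s a) ->
  - (t * (1 + mu / 2 * wdot (bellman V' h') (bellman V' h'))) <=
    \sum_s rho0 s * V' s + wdot (Z V h x) (bellman V' h').
Proof.
move=> t0 sub adm; have := sub (fun s => V s + t * V' s) _ adm.
rewrite Lmu_shift; set D := _ + wdot _ _; set M := mu / 2 * _ => le0.
rewrite -(ler_pM2l t0); lra.
Qed.

Definition near_feasible (d : R) (z : S -> A -> R) : Prop :=
  (forall s a, - d <= z s a) /\ forall s, `|netflow z s - rho0 s| <= d.

Lemma feasibleP z : feasible z <-> near_feasible 0 z.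
Proof.
split=> -[z0 zr]; split.
- by move=> s a; rewrite oppr0.
- by move=> s; rewrite -zr subrr normr0.
- by move=> s a; rewrite -oppr0.
- by move=> s; apply/subr0_eq/normr0_eq0/le_anti; rewrite normr_ge0 zr.
Qed.

Lemma near_feasibleW d e z : d <= e -> near_feasible d z -> near_feasible e z.
Proof.
move=> de [z0 zr]; split=> [s a|s]; last exact: le_trans (zr s) de.
by apply: le_trans (z0 s a); rewrite lerN2.
Qed.

Lemma wdot_sqr_le b K : (forall s a, `|b s a| <= K) -> wdot b b <= K ^+ 2.
Proof.
move=> bK; rewrite -[leRHS]mul1r -sum_w mulr_suml; apply: ler_sum => s _.
rewrite mulr_suml; apply: ler_sum => a _.
rewrite -mulrA ler_wpM2l ?w_ge0// -expr2 -real_normK ?num_real//.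
by rewrite ler_pXn2r// nnegrE// (le_trans _ (bK s a)).
Qed.

Lemma wdot_sqr_ge0 b : 0 <= wdot b b.
Proof.
by apply: sum2_ge0 => s a; rewrite -mulrA mulr_ge0 ?w_ge0// -expr2 sqr_ge0.
Qed.

Lemma wdot_sqr_term b s a : w s a * b s a ^+ 2 <= wdot b b.
Proof.
rewrite expr2 mulrA.
apply: (term_le_sum2 (F := fun s a => w s a * b s a * b s a)).
by move=> ? ?; rewrite -mulrA mulr_ge0 ?w_ge0// -expr2 sqr_ge0.
Qed.

Lemma wdot_dirac y s a :
  wdot y (fun s' a' => ((s' == s) && (a' == a))%:R) = w s a * y s a.
Proof.
rewrite /wdot (bigD1 s)//= (bigD1 a)//= !eqxx mulr1 big1 ?addr0; last first.
  by move=> a' /negPf ->; rewrite mulr0.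
rewrite big1 ?addr0// => s' /negPf s's; apply: big1 => a' _.
by rewrite s's mulr0.
Qed.

Lemma P_ge0 s a s' : 0 <= P s a s'.
Proof. by have [] := hP s a. Qed.

Lemma P_le1 s a s' : P s a s' <= 1.
Proof.
have [P0 <-] := hP s a; rewrite (bigD1 s')//= lerDl.
exact: sumr_ge0.
Qed.

(** Raising the slack [h] at [(s, a)] is always admissible, and the derivative
    of [Lmu] in this direction is [w s a * Zmu V h x s a]. *)
Lemma suboptimal_Z_ge V h x t s a :
  0 < t -> (forall s a, 0 <= h s a) -> suboptimal (t ^+ 2) V h x ->
  - (t * (1 + mu / 2)) <= w s a * Z V h x s a.
Proof.
move=> t0 h0 sub; have mu2 : 0 <= mu / 2 by rewrite divr_ge0// ltW.
pose e s' a' : R := ((s' == s) && (a' == a))%:R.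
have bell s' a' : bellman (fun=> 0) e s' a' = e s' a'.
  by rewrite /bellman big1 ?mulr0 ?addr0 ?subr0// => ? _; rewrite mulr0.
have := suboptimal_direction (fun=> 0) (h' := e) t0 sub.
rewrite [X in _ <= X + _]big1 ?add0r; last by move=> *; rewrite mulr0.
rewrite [X in _ <= X]wdot_bellman [X in _ - X]big1 ?subr0; last first.
  by move=> *; rewrite mulr0.
rewrite wdot_dirac => H; apply: le_trans (H _); last first.
  by move=> s' a'; rewrite addr_ge0// mulr_ge0// ltW.
rewrite lerN2 (ler_wpM2l (ltW t0))// lerD2l (ler_piMr mu2)//.
rewrite -[leRHS](expr1n _ 2); apply: wdot_sqr_le => s' a'.
by rewrite bell /e ger0_norm// lern1 leq_b1.
Qed.

(** Moving the value [V s] up and down is always admissible, and the derivative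
    of [Lmu] in these directions is, up to sign, the violation of the flow
    constraint at [s] by [Zmu V h x]. *)
Lemma suboptimal_netflow V h x t s :
  0 < t -> (forall s a, 0 <= h s a) -> suboptimal (t ^+ 2) V h x ->
  `|netflow (Z V h x) s - rho0 s| <= t * (1 + mu / 2).
Proof.
move=> t0 h0 sub; have mu2 : 0 <= mu / 2 by rewrite divr_ge0// ltW.
have dir c : `|c| = 1 ->
    - (t * (1 + mu / 2)) <= c * (rho0 s - netflow (Z V h x) s).
  move=> c1; pose e s' : R := c * (s' == s)%:R.
  have pick (F : S -> R) : \sum_s' F s' * e s' = c * F s.
    rewrite (bigD1 s)//= big1 ?addr0 => [|s' /negPf s's].
      by rewrite /e eqxx mulr1 mulrC.
    by rewrite /e s's !mulr0.
  have := suboptimal_direction e (h' := fun _ _ => 0) t0 sub.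
  rewrite [X in _ <= _ + X]wdot_bellman !pick.
  have -> : wdot (Z V h x) (fun _ _ => 0) = 0.
    by apply: big1 => s' _; apply: big1 => a _; rewrite mulr0.
  rewrite sub0r -mulrBr => H; apply: le_trans (H _); last first.
    by move=> s' a'; rewrite mulr0 addr0.
  rewrite lerN2 (ler_wpM2l (ltW t0))// lerD2l (ler_piMr mu2)//.
  rewrite -[leRHS](expr1n _ 2); apply: wdot_sqr_le => s' a'.
  rewrite /bellman pick /e add0r mulrCA -mulrBr normrM c1 mul1r.
  have /andP[g0 g1] := hgamma.
  have gP1 : gamma * P s' a' s <= 1 by rewrite mulr_ile1 ?P_ge0 ?P_le1 ?ltW.
  have gP0 : 0 <= gamma * P s' a' s by rewrite mulr_ge0 ?P_ge0 ?ltW.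
  by rewrite ler_norml; case: (s' == s) => /=; rewrite ?mulr1n ?mulr0n; lra.
have := dir 1 (normr1 _); have := dir (-1) (normrN1 _).
rewrite ler_norml mulN1r mul1r; lra.
Qed.

Lemma suboptimal_near_feasible m V h x d t :
  0 < m <= 1 -> (forall s a, m <= w s a) ->
  0 < t -> (forall s a, 0 <= h s a) -> suboptimal (t ^+ 2) V h x ->
  t * (1 + mu / 2) <= d * m -> near_feasible d (Z V h x).
Proof.
move=> /andP[m0 m1] mw t0 h0 sub tdm.
have tge0 : 0 <= t * (1 + mu / 2) by rewrite mulr_ge0 ?addr_ge0 ?divr_ge0 ?ltW.
have d0 : 0 <= d by rewrite -(pmulr_lge0 _ m0) (le_trans tge0).
split=> [s a|s].
  rewrite -(ler_pM2l (hw0 s a)).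
  apply: le_trans (suboptimal_Z_ge s a t0 h0 sub).
  by rewrite mulrN lerN2 (le_trans tdm)// mulrC ler_wpM2r.
apply: le_trans (suboptimal_netflow s t0 h0 sub) _.
by rewrite (le_trans tdm)// ler_piMr.
Qed.

(** Shrinking [(V, h)] towards 0 is admissible for [t <= 1], and its Hessian
    term involves only [bellman V h = (Zmu V h x - x) / mu - r]; so the bound
    does not depend on the size of [V] and [h] themselves, which need not stay
    bounded along the iteration.  Together with adjointness and [0 <= h], it
    gives the variational inequality that characterizes the proximal point of
    the linear program at [x]. *)
Lemma suboptimal_variational V h x y t :
  0 < t <= 1 -> (forall s a, 0 <= h s a) -> suboptimal (t ^+ 2) V h x ->
  feasible y ->
  - (t * (1 + mu / 2 * wdot (bellman V h) (bellman V h))) <=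
    wdot (fun s a => y s a - Z V h x s a) (bellman V h).
Proof.
move=> /andP[t0 t1] h0 sub [y0 yflow].
have bellN s a : bellman (fun s => - V s) (fun s a => - h s a) s a =
    - bellman V h s a.
  rewrite /bellman; under eq_bigr => s' _ do rewrite mulrN.
  rewrite sumrN; ring.
have := suboptimal_direction (fun s => - V s)
  (h' := fun s a => - h s a) t0 sub.
have -> : wdot (bellman (fun s => - V s) (fun s a => - h s a))
    (bellman (fun s => - V s) (fun s a => - h s a)) =
    wdot (bellman V h) (bellman V h).
  by apply: eq_bigr => s _; apply: eq_bigr => a _; rewrite bellN; ring.
move=> H; apply: le_trans (H _) _.
  by move=> s a; rewrite mulrN subr_ge0 ler_piMl.
have -> : wdot (Z V h x) (bellman (fun s => - V s) (fun s a => - h s a)) =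
    - wdot (Z V h x) (bellman V h).
  rewrite /wdot -sumrN; apply: eq_bigr => s _.
  by rewrite -sumrN; apply: eq_bigr => a _; rewrite bellN; ring.
have -> : wdot (fun s a => y s a - Z V h x s a) (bellman V h) =
    wdot y (bellman V h) - wdot (Z V h x) (bellman V h).
  rewrite /wdot -sumrB; apply: eq_bigr => s _.
  by rewrite -sumrB; apply: eq_bigr => a _; ring.
(* The common term cancels; what is left is [0 <= wdot y h]. *)
rewrite lerD2r wdot_bellman.
have -> : \sum_s netflow y s * V s = \sum_s rho0 s * V s.
  by apply: eq_bigr => s _; rewrite -yflow.
under eq_bigr => s _ do rewrite mulrN.
rewrite sumrN lerDr; apply: sum2_ge0 => s a.
by rewrite !mulr_ge0 ?w_ge0.
Qed.

(** * Distances in the weighted norm *)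

Definition wdist2 (u p : S -> A -> R) : R :=
  wdot (fun s a => u s a - p s a) (fun s a => u s a - p s a).

Lemma wdist2_ge0 u p : 0 <= wdist2 u p.
Proof. exact: wdot_sqr_ge0. Qed.

(** Law of cosines for the triangle [x], [Zmu V h x], [p], the increment
    [Zmu V h x - x] being [mu] times [bellman V h + r].  When the last term is
    almost nonnegative, as [suboptimal_variational] provides, passing from [x]
    to [Zmu V h x] brings the multiplier closer to [p] by the gap in the
    objective. *)
Lemma wdist2_Zmu V h x p :
  wdist2 x p = wdist2 (Z V h x) p + wdist2 x (Z V h x)
    + 2 * mu * (objective p - objective (Z V h x))
    + 2 * mu * wdot (fun s a => p s a - Z V h x s a) (bellman V h).
Proof.
rewrite /wdist2 /lp_objective /wdot -sumrB 2!mulr_sumr -!big_split.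
apply: eq_bigr => s _ /=.
rewrite -sumrB 2!mulr_sumr -!big_split; apply: eq_bigr => a _ /=.
rewrite !Zmu_bellman; ring.
Qed.

Lemma wdist2_perturb u v p K e :
  (forall s a, `|u s a - v s a| <= e) -> (forall s a, `|v s a - p s a| <= K) ->
  wdist2 u p <= wdist2 v p + (e ^+ 2 + 2 * e * K).
Proof.
move=> uv vp; rewrite -[X in _ <= _ + X]mul1r -[X in _ <= _ + X * _]sum_w.
rewrite mulr_suml -big_split; apply: ler_sum => s _ /=.
rewrite mulr_suml -big_split; apply: ler_sum => a _ /=.
rewrite -!mulrA -mulrDr ler_wpM2l ?w_ge0//.
have := uv s a; have := vp s a.
move: (u s a) (v s a) (p s a) => u' v' p' vp' uv'.
have -> : (u' - p') * (u' - p') =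
  (v' - p') * (v' - p') + (u' - v') ^+ 2 + 2 * ((u' - v') * (v' - p')) by ring.
have K0 : 0 <= K by rewrite (le_trans _ vp').
have e0 : 0 <= e by rewrite (le_trans _ uv').
rewrite -!addrA lerD2l lerD//.
  by rewrite -real_normK ?num_real// ler_pXn2r// nnegrE.
rewrite ler_wpM2l//; apply: le_trans (ler_norm _) _.
by rewrite normrM ler_pM.
Qed.

(** * Compactness of the feasible set *)

(** Summing the flow constraints over all states fixes the total mass: the
    weighted sum of [z] equals [1 / (1 - gamma)] up to the error, because each
    row of [P] sums to 1.  With almost nonnegative entries, the total mass
    bounds each entry, and the weights are bounded away from 0. *)
Lemma near_feasible_bounded : exists2 B, 0 < B & forall d z,
  d <= 1 -> near_feasible d z -> forall s a, `|z s a| <= B.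
Proof.
have /andP[g0 g1] := hgamma.
have [m m0 [m1 mw]] := w_lbound.
pose K : R := (1 + #|S|%:R) / (1 - gamma) + 1.
have g1' : 0 < 1 - gamma by rewrite subr_gt0.
have K1 : 1 <= K by rewrite lerDr divr_ge0 ?ltW// addr_ge0.
exists (K / m); first by rewrite divr_gt0// (lt_le_trans _ K1).
move=> d z d1 [z0 zflow] s a.
have total : (1 - gamma) * (\sum_s \sum_a w s a * z s a) = \sum_s netflow z s.
  have := wdot_bellman z (fun=> 1) (fun _ _ => 0).
  under [X in _ = _ - X]eq_bigr => s' _ do rewrite mulr1.
  have -> : wdot z (fun _ _ => 0) = 0.
    by apply: big1 => s' _; apply: big1 => a' _; rewrite mulr0.
  rewrite sub0r => /eqP; rewrite -eqr_oppLR => /eqP <-.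
  rewrite /wdot mulr_sumr -sumrN; apply: eq_bigr => s' _.
  rewrite mulr_sumr -sumrN; apply: eq_bigr => a' _.
  rewrite /bellman; under eq_bigr => s'' _ do rewrite mulr1.
  by have [_ ->] := hP s' a'; ring.
have mass : \sum_s \sum_a w s a * z s a <= K - 1.
  rewrite /K addrK ler_pdivlMr// mulrC total.
  have -> : 1 + #|S|%:R = \sum_s (rho0 s + 1) :> R.
    by have [_ rho1] := hrho0; rewrite big_split /= rho1 sumr_const.
  apply: ler_sum => s' _; have := zflow s'; rewrite ler_norml; lra.
(* Adding 1 makes all entries nonnegative, as the error is at most 1. *)
have shifted : w s a * (z s a + 1) <= \sum_s \sum_a w s a * (z s a + 1).
  apply: (term_le_sum2 (F := fun s a => w s a * (z s a + 1))) => s' a'.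
  by rewrite mulr_ge0 ?w_ge0//; have := z0 s' a'; lra.
have shiftE : \sum_s \sum_a w s a * (z s a + 1) =
    \sum_s \sum_a w s a * z s a + 1.
  rewrite -[X in _ + X]sum_w -big_split; apply: eq_bigr => s' _ /=.
  by rewrite -big_split; apply: eq_bigr => a' _ /=; rewrite mulrDr mulr1.
have mz : m * (z s a + 1) <= K.
  apply: (@le_trans _ _ (w s a * (z s a + 1))).
    by rewrite ler_wpM2r//; have := z0 s a; lra.
  by rewrite (le_trans shifted)// shiftE -lerBrDr.
have Km : z s a + 1 <= K / m by rewrite ler_pdivlMr// mulrC.
have Km1 : 1 <= K / m by rewrite ler_pdivlMr// mul1r (le_trans m1).
by rewrite ler_norml; have := z0 s a; lra.
Qed.

Lemma near_feasible_clusters (z : nat -> S -> A -> R) (l : S -> A -> R) :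
  clusters z l ->
  (forall d, 0 < d -> \forall n \near \oo, near_feasible d (z n)) ->
  feasible l.
Proof.
move=> zl zf; apply/feasibleP; split=> [s a|s].
  rewrite oppr0; apply/ler_addgt0Pl => e e0.
  have e2 : 0 < e / 2 by rewrite divr_gt0.
  have [N _ {}zf] := zf _ e2; have [n Nn /(_ s a)] := zl _ e2 N.
  have [/(_ s a) + _] := zf n Nn.
  by rewrite ler_norml => ? /andP[]; lra.
(* Used for [c = 1] and [c = -1]: an equality is two opposite inequalities. *)
have cl c : rho0 s * c <= netflow l s * c.
  have ->: netflow l s * c =
      dot (fun s0 a => ((s0 == s)%:R - gamma * P s0 a s) * w s0 a * c) l.
    rewrite netflow_dot mulr_suml; apply: eq_bigr => s0 _.
    by rewrite mulr_suml; apply: eq_bigr => a _; rewrite mulrAC.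
  apply: clusters_ge zl _ => e e0.
  have ec0 : 0 < e / (1 + `|c|) by rewrite divr_gt0// ltr_pwDl.
  apply: filterS (zf _ ec0) => n [_ /(_ s) zn].
  have -> : dot (fun s0 a => ((s0 == s)%:R - gamma * P s0 a s) * w s0 a * c)
      (z n) = netflow (z n) s * c.
    rewrite netflow_dot mulr_suml; apply: eq_bigr => s0 _.
    by rewrite mulr_suml; apply: eq_bigr => a _; rewrite mulrAC.
  have : `|(netflow (z n) s - rho0 s) * c| <= e.
    rewrite normrM; apply: le_trans (ler_wpM2r (normr_ge0 c) zn) _.
    by rewrite mulrAC ler_pdivrMr ?ltr_pwDl// ler_pM2l// lerDr.
  by rewrite ler_norml => /andP[]; lra.
have := cl 1; have := cl (-1).
by rewrite normr_le0 => ? ?; apply/eqP; lra.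
Qed.

Lemma clusters_objective_ge (z : nat -> S -> A -> R) (l : S -> A -> R) b :
  clusters z l ->
  (forall e, 0 < e -> \forall n \near \oo, b - e <= objective (z n)) ->
  b <= objective l.
Proof. exact: clusters_ge. Qed.

(** A maximizing sequence has a cluster point by compactness. *)
Lemma lp_optimal_exists : feasible !=set0 -> optimal !=set0.
Proof.
move=> [y0 y0f]; have [B B0 Bbound] := near_feasible_bounded.
have fB y s a : feasible y -> `|y s a| <= B.
  by move=> /feasibleP /(Bbound _ _ ler01).
pose E := [set objective y | y in feasible].
have supE : has_sup E.
  split; first by exists (objective y0), y0.
  exists (objective (fun _ _ => 0) + B * \sum_s \sum_a `|r s a * w s a|).
  move=> _ [y yf <-]; rewrite -lerBlDl.
  apply: le_trans (ler_norm _) (dot_lipschitz _ _) => s a.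
  by rewrite subr0; exact: fB.
have near n : exists y, feasible y /\ sup E - n.+1%:R^-1 <= objective y.
  have [|_ [y yf <-] /ltW] := sup_adherent (eps := n.+1%:R^-1) _ supE.
    by rewrite invr_gt0.
  by exists y.
have [z zP] := choice near.
have [l zl] := bounded_cluster (fun n s a => fB (z n) s a (zP n).1).
have lf : feasible l.
  apply: near_feasible_clusters zl _ => d d0; apply: nearW => n.
  by apply: near_feasibleW (ltW d0) _; apply/feasibleP; exact: (zP n).1.
exists l; split=> // y yf; apply: (@le_trans _ _ (sup E)).
  by apply: sup_ubound; [exact: supE.2|exists y].
apply: clusters_objective_ge zl _ => e e0.
apply: filterS (near_infty_natSinv_lt (PosNum e0)) => n /= /ltW ne.
by apply: le_trans (zP n).2; rewrite lerD2l lerN2.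
Qed.

(** Stability of the solution set: otherwise a sequence with vanishing
    violations that stays away from the solutions would cluster at a feasible
    point with optimal value, that is, at a solution. *)
Lemma near_optimal_near_solution p e : optimal p -> 0 < e ->
  exists2 d, 0 < d & forall z, near_feasible d z ->
    objective p - d <= objective z ->
    exists2 y, optimal y & forall s a, `|z s a - y s a| <= e.
Proof.
move=> [pf pmax] e0; apply: contrapT => nd.
have bad n : exists z, [/\ near_feasible n.+1%:R^-1 z,
    objective p - n.+1%:R^-1 <= objective z &
    ~ exists2 y, optimal y & forall s a, `|z s a - y s a| <= e].
  apply: contrapT => nz; apply: nd; exists n.+1%:R^-1.
    by rewrite invr_gt0.
  by move=> z zf zo; apply: contrapT => ny; apply: nz; exists z.
have [z zP] := choice bad.
have [B B0 Bbound] := near_feasible_bounded.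
have zB n s a : `|z n s a| <= B.
  have [zf _ _] := zP n; apply: (Bbound _ _ _ zf).
  by rewrite invf_le1// ler1n.
have [l zl] := bounded_cluster zB.
have lf : feasible l.
  apply: near_feasible_clusters zl _ => d d0.
  apply: filterS (near_infty_natSinv_lt (PosNum d0)) => n /= /ltW nd'.
  by have [zf _ _] := zP n; exact: near_feasibleW zf.
have lo : objective p <= objective l.
  apply: clusters_objective_ge zl _ => d d0.
  apply: filterS (near_infty_natSinv_lt (PosNum d0)) => n /= /ltW nd'.
  by have [_ zo _] := zP n; apply: le_trans zo; rewrite lerD2l lerN2.
have [n _ zln] := zl e e0 0%N.
have [_ _ []] := zP n; exists l => //; split=> // y yf.
by rewrite (le_trans _ lo)// pmax.
Qed.

Lemma eps_L_ge0 V h x : (forall s a, 0 <= h s a) ->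
  (0 <= eps_L P r rho0 w gamma mu V h x)%E.
Proof.
move=> h0; rewrite /eps_L /inf_Lmu sube_ge0; last by apply/orP; right.
by apply: ereal_inf_lbound; exists V, h.
Qed.

(** A finite bound on the error also rules out an infimum equal to [-oo], which
    is why the comparison passes from the extended reals to the reals. *)
Lemma eps_L_suboptimal V h x (e : R) :
  (eps_L P r rho0 w gamma mu V h x <= e%:E)%E -> suboptimal e V h x.
Proof.
move=> epse V' h' h'0.
rewrite -lerBlDl -lee_fin EFinB; apply: le_trans epse.
rewrite /eps_L /inf_Lmu; apply: leeB => //.
by apply: ereal_inf_lbound; exists V', h'.
Qed.

Lemma eps_xE V h x x' :
  eps_x P r w gamma mu V h x x' = wdist2 x' (Z V h x).
Proof.
by apply: eq_bigr => s _; apply: eq_bigr => a _; rewrite expr2 mulrA.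
Qed.

(** * Convergence of the inexact iteration *)

Section InexactIteration.
Context (V : nat -> S -> R) (h x : nat -> S -> A -> R).
Context (h0 : forall k s a, 0 <= h k s a).
Context (subopt : forall e : R, 0 < e ->
  \forall k \near \oo, suboptimal e (V k) (h k) (x k)).
Context (x_near : forall e : R, 0 < e -> \forall k \near \oo,
  forall s a, `|x k.+1 s a - Z (V k) (h k) (x k) s a| <= e).

Local Notation Zk k := (Z (V k) (h k) (x k)).

Lemma iterates_near_feasible (d : R) : 0 < d ->
  \forall k \near \oo, near_feasible d (Zk k).
Proof.
move=> d0; have [m m0 [m1 mw]] := w_lbound.
have [||t /andP[t0 _] td] := @small_factor R (1 + mu / 2) (d * m).
- by rewrite addr_ge0 ?divr_ge0 ?ltW.
- exact: mulr_gt0.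
apply: filterS (subopt (exprn_gt0 2 t0)) => k sub.
by apply: (@suboptimal_near_feasible m _ _ _ _ t); rewrite ?m0.
Qed.

(** The previous multiplier [x k] is close to the preceding [Zmu] and hence
    bounded as well, with 1 as room for the projection error; this holds from
    some rank on. *)
Lemma iterates_bounded : exists2 B, 0 < B &
  (forall y, feasible y -> forall s a, `|y s a| <= B) /\
  \forall k \near \oo, forall s a, `|Zk k s a| <= B /\ `|x k s a| <= B + 1.
Proof.
have [B B0 Bbound] := near_feasible_bounded.
exists B => //; split.
  by move=> y /feasibleP /(Bbound _ _ ler01).
have [N _ Nf] := iterates_near_feasible ltr01.
have [M _ Mx] := x_near ltr01.
exists (maxn N M).+1 => // -[//|k] /=; rewrite ltnS geq_max => /andP[Nk Mk] s a.
split; first exact: Bbound _ _ _ (Nf k.+1 (leqW Nk)) s a.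
have := Mx k Mk s a; have := Bbound _ _ (lexx 1) (Nf k Nk) s a.
rewrite !ler_norml => /andP[? ?] /andP[? ?]; apply/andP; split; lra.
Qed.

(** The approximate minimizers of the augmented Lagrangian produce the feasible
    point: a cluster point of the nearly feasible [Zmu] sequence. *)
Lemma feasible_nonempty : feasible !=set0.
Proof.
have [B _ [_ [N _ NB]]] := iterates_bounded.
have zB n s a : `|Zk (N + n)%N s a| <= B by have [] := NB _ (leq_addr n N) s a.
have [l zl] := bounded_cluster zB.
exists l; apply: near_feasible_clusters zl _ => d.
move=> /iterates_near_feasible[M _ Mf].
by exists M => // n /= Mn; apply: Mf; rewrite /= (leq_trans Mn)// leq_addl.
Qed.

Lemma iterates_variational (e : R) : 0 < e -> \forall k \near \oo, forall y,
  feasible y ->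
  - e <= wdot (fun s a => y s a - Zk k s a) (bellman (V k) (h k)).
Proof.
move=> e0; have [B B0 [_ Bk]] := iterates_bounded.
pose K := (B + B + 1) / mu + \sum_s \sum_a `|r s a|.
have mu2 : 0 <= mu / 2 by rewrite divr_ge0 ?ltW.
have [||t /andP[t0 t1] te] := @small_factor R (1 + mu / 2 * K ^+ 2) e => //.
  by rewrite addr_ge0// mulr_ge0// sqr_ge0.
apply: filterS2 Bk (subopt (exprn_gt0 2 t0)) => k kB sub y yf.
apply: le_trans (suboptimal_variational _ _ sub yf); rewrite ?t0//.
rewrite lerN2 (le_trans _ te)// (ler_wpM2l (ltW t0))// lerD2l (ler_wpM2l mu2)//.
apply: wdot_sqr_le => s a; have [ZB xB] := kB s a.
have -> : bellman (V k) (h k) s a = (Zk k s a - x k s a) / mu - r s a.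
  by rewrite Zmu_bellman; field; rewrite gt_eqF.
apply: le_trans (ler_normB _ _) _; apply: lerD.
  rewrite normrM [`|mu^-1|]gtr0_norm ?invr_gt0// ler_pM2r ?invr_gt0//.
  apply: le_trans (ler_normB _ _) _; lra.
exact: (term_le_sum2 (F := fun s a => `|r s a|)).
Qed.

(** At each late step, either the new [Zmu] is nearly optimal for the linear
    program, and then the next multiplier is close to a solution by stability;
    or its objective falls short by [d], and then the distance to every solution
    drops by an amount that is the same for all late steps. *)
Lemma iterates_near_optimal (e : R) : 0 < e ->
  \forall k \near \oo, exists2 p, optimal p & wdist2 (x k) p <= e.
Proof.
have [p0 p0opt] := lp_optimal_exists feasible_nonempty.
have [B B0 [fB Bk]] := iterates_bounded.
apply: quasi_descent_cvg; first by exists p0.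
  by move=> k p; exact: wdist2_ge0.
move=> {}e e0.
have [|e1 /andP[e1_gt0 e1_le1] e1e] := @small_factor R 4 e _ e0 => //.
have [d d0 stable] := near_optimal_near_solution p0opt e1_gt0.
pose c := mu * d / 2; have c0 : 0 < c by rewrite divr_gt0// mulr_gt0.
have [|e2 /andP[e2_gt0 e2_le1] e2c] := @small_factor R (1 + 4 * B) c _ c0.
  by rewrite addr_ge0// mulr_ge0// ltW.
have d2 : 0 < d / 2 by rewrite divr_gt0.
exists c => //; near=> k.
have Zf : near_feasible d (Zk k) by near: k; exact: iterates_near_feasible.
have xZ1 s a : `|x k.+1 s a - Zk k s a| <= e1.
  by move: s a; near: k; exact: x_near.
have xZ2 s a : `|x k.+1 s a - Zk k s a| <= e2.
  by move: s a; near: k; exact: x_near.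
have ZB s a : `|Zk k s a| <= B.
  have [] // : `|Zk k s a| <= B /\ `|x k s a| <= B + 1.
  by move: s a; near: k; exact: Bk.
have var y : feasible y ->
    - (d / 2) <= wdot (fun s a => y s a - Zk k s a) (bellman (V k) (h k)).
  by move: y; near: k; exact: iterates_variational.
have [obj_ge|obj_lt] := leP (objective p0 - d) (objective (Zk k)).
  left; have [y yopt Zy] := stable _ Zf obj_ge; exists y => //.
  apply: (@le_trans _ _ ((e1 + e1) ^+ 2)).
    apply: wdot_sqr_le => s a.
    have -> : x k.+1 s a - y s a =
      (x k.+1 s a - Zk k s a) + (Zk k s a - y s a) by ring.
    by apply: le_trans (ler_normD _ _) _; apply: lerD.
  apply: le_trans e1e; have -> : (e1 + e1) ^+ 2 = e1 * 4 * e1 by ring.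
  by rewrite ler_piMr// mulr_ge0// ltW.
(* The gap [d] is worth [2 * mu * d]; the error of the variational inequality
   costs [mu * d], that of the projection [mu * d / 2], leaving [c]. *)
right=> p [pf pmax].
have Zp s a : `|Zk k s a - p s a| <= B + B.
  by apply: le_trans (ler_normB _ _) _; apply: lerD; [exact: ZB|exact: fB].
apply: le_trans (wdist2_perturb xZ2 Zp) _.
have objp := pmax p0 p0opt.1.
have varp := var p pf.
have perturb : e2 ^+ 2 + 2 * e2 * (B + B) <= c.
  apply: le_trans e2c; have -> : 2 * e2 * (B + B) = e2 * (4 * B) by ring.
  by rewrite mulrDr mulr1 lerD2r expr2 ler_piMr// ltW.
have descent : 2 * mu * (d / 2) <= 2 * mu * (objective p - objective (Zk k) +
    wdot (fun s a => p s a - Zk k s a) (bellman (V k) (h k))).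
  by rewrite ler_wpM2l ?mulr_ge0 ?(ltW hmu)//; lra.
rewrite (wdist2_Zmu (V k) (h k) (x k) p).
have := wdist2_ge0 (x k) (Zk k); move: descent perturb.
rewrite /c; lra.
Unshelve. all: by end_near.
Qed.

End InexactIteration.
End MarkovDecisionProcess.

Theorem theorem5p3 (R : realType) (S A : finType)
    (P : S -> A -> S -> R) (hP : is_kernel P)
    (r : S -> A -> R)
    (rho0 : S -> R) (hrho0 : is_distribution rho0)
    (gamma : R) (hgamma : 0 < gamma < 1)
    (mu : R) (hmu : 0 < mu)
    (w : S -> A -> R)
    (hw : is_distribution (fun sa : S * A => w sa.1 sa.2))
    (hw0 : forall s a, 0 < w s a)
    (Phi Psi Theta : Type)
    (V : Phi -> S -> R)
    (h : Psi -> S -> A -> R) (hh : forall psi s a, 0 <= h psi s a)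
    (x : Theta -> S -> A -> R)
    (phi : nat -> Phi) (psi : nat -> Psi) (theta : nat -> Theta)
    (heps_L : (\sum_(0 <= k <oo)
       eps_L P r rho0 w gamma mu
         (V (phi k.+1)) (h (psi k.+1)) (x (theta k)) < +oo)%E)
    (heps_x : (\sum_(0 <= k <oo)
       (eps_x P r w gamma mu
         (V (phi k.+1)) (h (psi k.+1)) (x (theta k)) (x (theta k.+1)))%:E
       < +oo)%E) :
  cvg_to_set (fun k => x (theta k)) (lp_optimal P r rho0 w gamma) /\
  (forall xopt : S -> A -> R, lp_optimal P r rho0 w gamma = [set xopt] ->
     forall s a, x (theta k) s a @[k --> \oo] --> xopt s a).
Proof.
pose xs k := x (theta k); pose hs k := h (psi k.+1); pose Vs k := V (phi k.+1).
have [m m0 [m1 mw]] := w_lbound hw0.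
have hs0 k s a : 0 <= hs k s a by exact: hh.
have subopt e : 0 < e -> \forall k \near \oo,
    suboptimal P r rho0 gamma mu w e (Vs k) (hs k) (xs k).
  move=> e0; apply: filterS (nneseries_term_near0 _ heps_L e0) => k.
    exact: eps_L_suboptimal.
  exact: eps_L_ge0.
have of_wdist2 u p e : 0 <= e -> wdist2 w u p <= m * e ^+ 2 ->
    forall s a, `|u s a - p s a| <= e.
  move=> e0 up s a; rewrite -(@ler_pXn2r _ 2)// ?nnegrE//.
  rewrite real_normK ?num_real// -(ler_pM2l m0); apply: le_trans up.
  apply: le_trans (wdot_sqr_term hw0 _ s a).
  by rewrite ler_wpM2r ?sqr_ge0.
have x_near e : 0 < e -> \forall k \near \oo, forall s a,
    `|xs k.+1 s a - Zmu P r gamma mu (Vs k) (hs k) (xs k) s a| <= e.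
  move=> e0; have me0 : 0 < m * e ^+ 2 by rewrite mulr_gt0 ?exprn_gt0.
  apply: filterS (nneseries_term_near0 _ heps_x me0) => k.
    by rewrite lee_fin eps_xE => /of_wdist2; apply; exact: ltW.
  by rewrite lee_fin eps_xE wdist2_ge0.
have dist_cvg : cvg_to_set xs (lp_optimal P r rho0 w gamma).
  move=> e e0; have e2 : 0 < e / 2 by rewrite divr_gt0.
  have me0 : 0 < m * (e / 2) ^+ 2 by rewrite mulr_gt0 ?exprn_gt0.
  apply: filterS (iterates_near_optimal hP hrho0 hgamma hmu hw hw0 hs0 subopt
    x_near me0) => k [p popt xp].
  exists p => // s a; apply: le_lt_trans (of_wdist2 _ _ _ (ltW e2) xp s a) _.
  by rewrite ltr_pdivrMr// ltr_pMr// ltr1n.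
split=> // xopt Xopt s a; apply/cvgrPdist_lt => e e0.
apply: filterS (dist_cvg e e0) => k [y].
by rewrite Xopt => -> /(_ s a); rewrite distrC.
Qed.
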